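(* Fix $m\ge2$ and let $f(\ell)=o(1)$. Suppose there exists a function $k:\mathbb N\to\mathbb N$ with $k(\ell)\le \ell$ for all $\ell$ such that, as $\ell\to\infty$, $$k(\ell)-2\ell f(\ell)\to\infty \qquad\text{and}\qquad \frac{\ell-2}{(2k(\ell)+2)(2m-1)^{2k(\ell)}}\to\infty .$$ Then asymptotically almost surely a random group $G\in\mathcal H(f)$ is isomorphic to $1$ or to $\mathbb Z/2\mathbb Z$.
   Context: The random group model $\mathcal H(f)$: for each length $\ell$, choose $(2m-1)^{\ell(\frac12-f(\ell))}$ relators (an integer count), independently and uniformly at random from the freely reduced words of length $\ell$ (not necessarily cyclically reduced) in $m$ generators and their inverses; $G$ is the group presented by the $m$ generators and these relators. ''Asymptotically almost surely'' means with probability tending to $1$ as $\ell\to\infty$. *)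

(* Defs.v *)
From Stdlib Require Import Reals ClassicalEpsilon ZArith.
From mathcomp Require Import all_boot fingroup ssralg zmodp.

Set Implicit Arguments.
Unset Strict Implicit.
Unset Printing Implicit Defensive.

(* Letters of the free group on m generators: (i, false) = x_i, (i, true) = x_i^-1. *)
Definition letter (m : nat) : finType := ('I_m * bool)%type.
Definition word (m : nat) := seq (letter m).

Definition linv m (x : letter m) : letter m := (x.1, ~~ x.2).

Definition freely_reduced m (w : word m) : bool :=
  sorted (fun x y : letter m => y != linv x) w.

(* The congruence on words defining the group < x_1..x_m | Rs >:
   free cancellation and insertion/deletion of a relator anywhere. *)
Inductive wrel m (Rs : seq (word m)) : word m -> word m -> Prop :=
| wrel_refl w : wrel Rs w w
| wrel_sym u v : wrel Rs u v -> wrel Rs v u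
| wrel_trans u v w : wrel Rs u v -> wrel Rs v w -> wrel Rs u w
| wrel_cancel u v x : wrel Rs (u ++ x :: linv x :: v) (u ++ v)
| wrel_rel u v r : r \in Rs -> wrel Rs (u ++ r ++ v) (u ++ v).

Definition eval_letter m (gT : finGroupType) (phi : 'I_m -> gT) (x : letter m) : gT :=
  if x.2 then ((phi x.1)^-1)%g else phi x.1.

Definition eval_word m (gT : finGroupType) (phi : 'I_m -> gT) (w : word m) : gT :=
  foldr (fun x acc => (eval_letter phi x * acc)%g) 1%g w.

(* The group presented by < x_1..x_m | Rs > is isomorphic to gT:
   some assignment of generators kills all relators (so induces a
   homomorphism from the presented group), is surjective, and has
   trivial kernel (injective on the presented group). *)
Definition presented_iso m (Rs : seq (word m)) (gT : finGroupType) : Prop :=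
  exists phi : 'I_m -> gT,
    [/\ forall r, r \in Rs -> eval_word phi r = 1%g,
        forall h : gT, exists w : word m, eval_word phi w = h
      & forall w : word m, eval_word phi w = 1%g -> wrel Rs w [::]].

Definition trivial_grp : finGroupType := 'I_1.
Definition Z2_grp : finGroupType := 'I_2.

Definition pb (P : Prop) : bool := if excluded_middle_informative P then true else false.

Definition nrel (m : nat) (f : nat -> R) (l : nat) : nat :=
  Z.to_nat (Int_part (Rpower (INR (2 * m - 1)) (Rmult (INR l) (Rminus (Rinv 2) (f l))))).

Definition sample (m l N : nat) : finType := {ffun 'I_N -> l.-tuple (letter m)}.

Definition relators m l N (t : sample m l N) : seq (word m) :=
  [seq tval (t i) | i <- enum 'I_N].

Definition admissible m l N (t : sample m l N) : bool :=
  [forall i, freely_reduced (tval (t i))].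

Definition prob_H (m : nat) (f : nat -> R) (P : seq (word m) -> Prop) (l : nat) : R :=
  Rdiv (INR #|[set t : sample m l (nrel m f l) | admissible t && pb (P (relators t))]|)
  (INR #|[set t : sample m l (nrel m f l) | admissible t]|).

Definition aas (m : nat) (f : nat -> R) (P : seq (word m) -> Prop) : Prop :=
  Un_cv (prob_H f P) (IZR 1).

(* Main.v *)
Require Import Defs.
From Stdlib Require Import Reals ClassicalEpsilon Lra.
From mathcomp Require Import all_boot all_order all_algebra fingroup ring lra zify.
From mathcomp Require Import Rstruct.

Set Implicit Arguments.
Unset Strict Implicit.
Unset Printing Implicit Defensive.

(**
Write n = 2m - 1 and cut off four disjoint batches of q ~ N/4 relators each.

A relator of the first batch and one of the second share their first
l - (k+1) letters and no more with high probability, since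
N^2 n^(k-l) = n^(k - 2 l f) tends to infinity (birthday paradox). Their tails
give a reduced word z of length 2(k+1) that is trivial in the group.

A random word of length l - 2 contains z in a position where z can be deleted
without further cancellation, with probability at least 1/2, because
l / ((2k+2) n^(2k)) tends to infinity. Deleting z leaves only about n^(l-2k)
different words, so for given letters x and y the birthday paradox applies to
the third and fourth batches: with high probability there are relators ux and
u'y such that deleting z turns u and u' into the same word, whence x = y in the
group. When all letters (inverses included) are equal, the group is 1 or Z/2.

Both birthday arguments are one second moment estimate ([collision]).
*)

(** * Second moment method *)

Section Averages.
Import Order.TTheory GRing.Theory Num.Theory.
Local Open Scope ring_scope.
Variables (F : realFieldType) (T : eqType) (W : seq T).
Hypothesis W_gt0 : (0 < size W)%N.

Definition avg (g : T -> F) : F := (\sum_(s <- W) g s) / (size W)%:R.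

(** Expectation over [N] independent uniform draws from [W]. As an iterated average, it makes fixing
    an initial batch the same as conditioning on it. *)
Fixpoint Exp N (g : seq T -> F) : F :=
  if N is N'.+1 then avg (fun s => Exp N' (fun l => g (s :: l))) else g [::].

Let W_neq0 : (size W)%:R != 0 :> F.
Proof. by rewrite pnatr_eq0 -lt0n. Qed.

Lemma eq_avg g h : g =1 h -> avg g = avg h.
Proof. by move=> gh; rewrite /avg (eq_bigr h). Qed.

Lemma le_avg g h : {in W, forall s, g s <= h s} -> avg g <= avg h.
Proof.
move=> gh; rewrite /avg ler_wpM2r ?invr_ge0 ?ler0n //.
by rewrite big_seq [leRHS]big_seq; apply: ler_sum.
Qed.

Lemma avg_cst c : avg (fun=> c) = c.
Proof.
by rewrite /avg big_const_seq count_predT iter_addr_0 -[c *+ _]mulr_natr mulfK.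
Qed.

Lemma avgD g h : avg (fun s => g s + h s) = avg g + avg h.
Proof. by rewrite /avg big_split mulrDl. Qed.

Lemma avgZ c g : avg (fun s => c * g s) = c * avg g.
Proof. by rewrite /avg -mulr_sumr mulrA. Qed.

Lemma exchange_avg (g : T -> T -> F) :
  avg (fun r => avg (g r)) = avg (fun s => avg (g^~ s)).
Proof. by rewrite /avg -!mulr_suml exchange_big. Qed.

Lemma eq_Exp N g h : g =1 h -> Exp N g = Exp N h.
Proof.
elim: N g h => [|N IHN] g h gh /=; first exact: gh.
by apply: eq_avg => s; apply: IHN => l; apply: gh.
Qed.

Lemma le_Exp N g h :
  (forall l, size l = N -> {subset l <= W} -> g l <= h l) -> Exp N g <= Exp N h.
Proof.
elim: N g h => [|N IHN] g h gh /=; first exact: gh.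
apply: le_avg => s sW; apply: IHN => l sz lW; apply: gh; first by rewrite /= sz.
by move=> x; rewrite inE => /predU1P[->|/lW].
Qed.

Lemma Exp_cst N c : Exp N (fun=> c) = c.
Proof. by elim: N => //= N IHN; rewrite (eq_avg (fun=> IHN)) avg_cst. Qed.

Lemma ExpD N g h : Exp N (fun l => g l + h l) = Exp N g + Exp N h.
Proof.
by elim: N g h => //= N IHN g h; rewrite -avgD; apply: eq_avg => s; rewrite IHN.
Qed.

Lemma ExpZ N c g : Exp N (fun l => c * g l) = c * Exp N g.
Proof.
by elim: N g => //= N IHN g; rewrite -avgZ; apply: eq_avg => s; rewrite IHN.
Qed.

Lemma Exp_avg N (g : T -> seq T -> F) :
  Exp N (fun l => avg (g^~ l)) = avg (fun s => Exp N (g s)).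
Proof.
elim: N g => //= N IHN g; rewrite exchange_avg; apply: eq_avg => s.
exact: (IHN (fun s' l => g s' (s :: l))).
Qed.

Lemma Exp_cat a b g :
  Exp (a + b) g = Exp a (fun l1 => Exp b (fun l2 => g (l1 ++ l2))).
Proof.
elim: a g => [|a IHa] g //=; apply: eq_avg => s.
exact: (IHa (fun l => g (s :: l))).
Qed.

Lemma Exp_sum (I : Type) (js : seq I) N (g : I -> seq T -> F) :
  Exp N (fun l => \sum_(j <- js) g j l) = \sum_(j <- js) Exp N (g j).
Proof.
elim: js => [|j js IHj].
  by rewrite big_nil -[RHS](Exp_cst N 0); apply: eq_Exp => l; rewrite big_nil.
by rewrite big_cons -IHj -ExpD; apply: eq_Exp => l; rewrite big_cons.
Qed.

(** Second moment as squared mean plus variance; variances of independent summands add up. The shift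
    [c] carries the induction and later centres the sum. *)
Lemma Exp_sum_sqr N c phi :
  Exp N (fun l => (c + \sum_(s <- l) phi s) ^+ 2) =
  (c + N%:R * avg phi) ^+ 2 + N%:R * (avg (fun s => phi s ^+ 2) - avg phi ^+ 2).
Proof.
elim: N c => [|N IHN] c /=; first by rewrite big_nil; ring.
pose mu := avg phi.
have step s : Exp N (fun l => (c + \sum_(s' <- s :: l) phi s') ^+ 2) =
  ((c + N%:R * mu) ^+ 2 + N%:R * (avg (fun s => phi s ^+ 2) - mu ^+ 2))
  + ((2 * (c + N%:R * mu)) * phi s + phi s ^+ 2).
  transitivity (Exp N (fun l => ((c + phi s) + \sum_(s' <- l) phi s') ^+ 2)).
    by apply: eq_Exp => l; rewrite big_cons addrA.
  by rewrite IHN -/mu; ring.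
rewrite (eq_avg step) !avgD !avg_cst avgZ -/mu -natr1; ring.
Qed.

Section Collision.
Variables (A : T -> T -> bool) (q : nat) (d p : F).
Hypotheses (q_gt0 : (0 < q)%N) (p_gt0 : 0 < p).
Let a r s : F := (A r s)%:R.
Hypothesis p_le : p <= avg (fun r => avg (a r)).
Hypothesis degl : {in W, forall r, avg (a r) <= d}.
Hypothesis degr : {in W, forall s, avg (a^~ s) <= d}.

Let ge0_avg g : (forall s, 0 <= g s) -> 0 <= avg g.
Proof.
move=> g0; rewrite -(avg_cst 0); apply: le_avg => s _; exact: g0.
Qed.

Let sqr_deg_le (g : T -> F) : (forall s, 0 <= g s) ->
  {in W, forall s, g s <= d} -> avg (fun s => g s ^+ 2) <= d * avg g.
Proof.
move=> g0 gd; rewrite -avgZ; apply: le_avg => s sW.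
by rewrite expr2 ler_wpM2r // gd.
Qed.

(** Chebyshev's inequality for the number of related pairs between two batches. Besides single
    pairs, only two pairs sharing a word contribute to the variance, and the degree bound [d]
    controls these on either side. *)
Lemma collision :
  Exp q (fun g => Exp q (fun h => (~~ has (fun r => has (A r) h) g)%:R)) <=
  (q%:R ^+ 2 * p)^-1 + 2 * d / (q%:R * p).
Proof.
pose P := avg (fun r => avg (a r)).
pose Q : F := q%:R.
pose mu := Q ^+ 2 * P.
pose X g h : F := \sum_(s <- h) \sum_(r <- g) a r s.
have a0 r s : 0 <= a r s by rewrite ler0n.
have Q_gt0 : 0 < Q by rewrite ltr0n.
have P_gt0 : 0 < P by apply: lt_le_trans p_le.
have mu_gt0 : 0 < mu by rewrite mulr_gt0 // exprn_gt0.
have muS : 0 < mu ^+ 2 by rewrite exprn_gt0.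
(* With no related pair [X g h] is 0, and the right-hand side is exactly 1. *)
have chebyshev g h :
    (~~ has (fun r => has (A r) h) g)%:R <= (mu ^+ 2)^-1 * (- mu + X g h) ^+ 2.
  case: (boolP (has _ g)) => [_|no_pair] /=.
    by rewrite mulr_ge0 ?invr_ge0 ?sqr_ge0.
  suff -> : X g h = 0 by rewrite addr0 sqrrN mulVf ?lt0r_neq0.
  rewrite /X big_seq big1 // => s sh; rewrite big_seq big1 // => r rg.
  rewrite /a; case: (boolP (A r s)) => // Ars; case/hasP: no_pair.
  by exists r => //; apply/hasP; exists s.
have le1 : Exp q (fun g => Exp q (fun h => (~~ has (fun r => has (A r) h) g)%:R))
  <= (mu ^+ 2)^-1 * Exp q (fun g => Exp q (fun h => (- mu + X g h) ^+ 2)).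
  rewrite -ExpZ; apply: le_Exp => g _ _; rewrite -ExpZ.
  by apply: le_Exp => h _ _; apply: chebyshev.
pose tau g s : F := \sum_(r <- g) a r s.
have avg_tau g : avg (tau g) = \sum_(r <- g) avg (a r).
  by rewrite /avg /tau exchange_big mulr_suml.
(* For fixed [g] the count is a sum of [q] independent copies of [tau g]; the subtracted square of
   the mean is dropped. *)
have le2 g : Exp q (fun h => (- mu + X g h) ^+ 2) <=
    Q ^+ 2 * (- (Q * P) + \sum_(r <- g) avg (a r)) ^+ 2
    + Q * avg (fun s => tau g s ^+ 2).
  rewrite Exp_sum_sqr -/Q -/(tau g) avg_tau /mu.
  have := mulr_ge0 (ltW Q_gt0) (sqr_ge0 (\sum_(r <- g) avg (a r))).
  rewrite -subr_ge0 => h0; rewrite -subr_ge0; apply: le_trans h0 _.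
  by rewrite le_eqVlt; apply/orP; left; apply/eqP; ring.
(* The three terms account for pairs sharing [r], pairs sharing [s], and single pairs. *)
have le3 : Exp q (fun g => Exp q (fun h => (- mu + X g h) ^+ 2)) <=
    Q ^+ 3 * (d * P) + Q ^+ 3 * (d * P) + Q ^+ 2 * P.
  apply: le_trans (le_Exp (fun g _ _ => le2 g)) _.
  rewrite ExpD !ExpZ Exp_sum_sqr -/P -/Q.
  have -> : Exp q (fun g => avg (fun s => tau g s ^+ 2)) =
            avg (fun s => Exp q (fun g => (0 + tau g s) ^+ 2)).
    rewrite -Exp_avg; apply: eq_Exp => g; apply: eq_avg => s; by rewrite add0r.
  have tauE : avg (fun s => Exp q (fun g => (0 + tau g s) ^+ 2)) <=
      avg (fun s => Q ^+ 2 * avg (a^~ s) ^+ 2 + Q * avg (a^~ s)).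
    apply: le_avg => s _; rewrite Exp_sum_sqr -/Q.
    have -> : avg (fun r => a r s ^+ 2) = avg (a^~ s).
      by apply: eq_avg => r; rewrite /a; case: (A r s); rewrite ?expr1n ?expr0n.
    have := mulr_ge0 (ltW Q_gt0) (sqr_ge0 (avg (a^~ s))); lra.
  have := ler_wpM2l (ltW Q_gt0) tauE.
  rewrite avgD !avgZ -exchange_avg -/P => tauE'.
  have dl : avg (fun r => avg (a r) ^+ 2) <= d * P.
    by apply: sqr_deg_le => // r; apply: ge0_avg.
  have dr : avg (fun s => avg (a^~ s) ^+ 2) <= d * P.
    rewrite /P exchange_avg; apply: sqr_deg_le => // r; exact: ge0_avg.
  have Q3 : 0 <= Q ^+ 3 by rewrite exprn_ge0 // ltW.
  have := ler_wpM2l Q3 dl; have := ler_wpM2l Q3 dr.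
  have := mulr_ge0 Q3 (sqr_ge0 P).
  move: tauE'; set E1 := avg _; set E2 := avg _; set E3 := avg _.
  rewrite addNr expr0n /= add0r; move=> *; nra.
apply: le_trans le1 _.
apply: le_trans (ler_wpM2l _ le3) _; first by rewrite invr_ge0 ltW.
have -> : (mu ^+ 2)^-1 * (Q ^+ 3 * (d * P) + Q ^+ 3 * (d * P) + Q ^+ 2 * P)
  = (Q ^+ 2 * P)^-1 + 2 * d / (Q * P).
  by rewrite /mu; field; rewrite !lt0r_neq0.
have d0 : 0 <= d.
  case: (W) W_gt0 degl => // w W' _ dd.
  by apply: le_trans (dd w (mem_head _ _)); apply: ge0_avg.
have le_inv (u : F) : 0 < u -> (u * P)^-1 <= (u * p)^-1.
  move=> u_gt0; rewrite lef_pV2 ?posrE; try exact: mulr_gt0.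
  by apply: ler_wpM2l p_le; apply: ltW.
apply: lerD; first by apply: le_inv; apply: exprn_gt0.
by apply: ler_wpM2l (le_inv _ Q_gt0); apply: mulr_ge0.
Qed.

End Collision.
End Averages.

(** * Reduced words *)

Lemma leq_sum_mem (T : eqType) (s : seq T) (F : T -> nat) x :
  x \in s -> F x <= \sum_(y <- s) F y.
Proof. by move=> xs; rewrite (big_rem x) //= leq_addr. Qed.

(** For [J >= Y] the first two binomial terms of [((Y - 1) + 1)^J] are each at least [(Y - 1)^J].
    Thus [J] independent trials with success probability [1/Y] all fail with probability at most
    1/2. *)
Lemma bernoulli Y J : 0 < Y -> Y <= J -> 2 * Y.-1 ^ J <= Y ^ J.
Proof.
case: Y J => // y [|J] //= _ yJ.
suff h i : y ^ i.+1 + i.+1 * y ^ i <= y.+1 ^ i.+1.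
  apply: leq_trans (h J); rewrite mul2n -addnn leq_add2l expnS leq_mul2r.
  by rewrite (leq_trans _ yJ) ?orbT.
elim: i => [|i IHi]; first by rewrite !expn1 expn0; lia.
rewrite [leqRHS]expnS; apply: leq_trans (leq_mul (leqnn _) IHi).
by rewrite !expnS; nia.
Qed.

Section Words.
Variable m : nat.
Local Notation L := (letter m).
Local Notation W := (word m).

Definition nocancel (x y : L) := y != linv x.

Lemma linvK : involutive (@linv m).
Proof. by case=> i b; rewrite /linv /= negbK. Qed.

Lemma nocancelC x y : nocancel x y = nocancel y x.
Proof. by rewrite /nocancel -(can_eq linvK) linvK eq_sym. Qed.

(** Source of the free choices of letters below: at most three are excluded at a time, and [m >= 2]
    gives at least four. *)
Lemma avoid_letters (s : seq L) : size s < 2 * m -> exists x : L, x \notin s.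
Proof.
move=> lt_s; have: #|predC (mem s)| > 0.
  rewrite -subn_gt0 in lt_s; rewrite -(leq_add2l #|mem s|) cardC addn1.
  rewrite card_prod card_ord card_bool.
  by apply: leq_ltn_trans (card_size s) _; lia.
by case/card_gt0P=> x xs; exists x.
Qed.

Definition follows (o : option L) (w : W) :=
  if o is Some a then path nocancel a w else sorted nocancel w.

Definition olast (o : option L) (w : W) :=
  if w is x :: s then Some (last x s) else o.

(* [o] is the letter that precedes the word, if any. *)
Fixpoint redwords (o : option L) l : seq W :=
  if l is l'.+1 then
    [seq x :: w | x <- [seq x <- enum L | follows o [:: x]], w <- redwords (Some x) l']
  else [:: [::]].

Lemma follows_cons o x w :
  follows o (x :: w) = follows o [:: x] && follows (Some x) w.
Proof. by case: o => //= a; rewrite andbT. Qed.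

Lemma follows_cat o u v : follows o (u ++ v) = follows o u && follows (olast o u) v.
Proof.
elim: u o => [|x u IHu] o; first by case: o.
by rewrite cat_cons follows_cons IHu [in RHS]follows_cons andbA; case: u {IHu}.
Qed.

Lemma mem_redwords o l w : (w \in redwords o l) = (size w == l) && follows o w.
Proof.
elim: l o w => [|l IHl] o w /=; first by case: w => //; case: o.
apply/allpairsPdep/andP => [[x [v [xo vl ->]]]|[szw wo]].
  rewrite mem_filter mem_enum andbT in xo.
  by move: vl; rewrite IHl follows_cons xo => /andP[/eqP<- ->].
case: w szw wo => // x v szv; rewrite follows_cons => /andP[ox xv].
by exists x, v; rewrite mem_filter mem_enum ox IHl xv -eqSS szv.
Qed.

Lemma redwords_uniq o l : uniq (redwords o l).
Proof.
elim: l o => //= l IHl o; apply: allpairs_uniq_dep => [|x _|].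
- by rewrite filter_uniq // enum_uniq.
- exact: IHl.
- by move=> [x u] [y v] _ _ [-> ->].
Qed.

Lemma size_redwordsP o l w : w \in redwords o l -> size w = l.
Proof. by rewrite mem_redwords => /andP[/eqP]. Qed.

Lemma big_redwordsS o l (F : W -> nat) :
  \sum_(w <- redwords o l.+1) F w =
  \sum_(x | follows o [:: x]) \sum_(w <- redwords (Some x) l) F (x :: w).
Proof. by rewrite /= big_allpairs_dep big_filter big_enum_cond. Qed.

Arguments redwords : simpl never.

(** As in a Markov chain, the right part of a reduced word depends on the left part only through its
    last letter. *)
Lemma big_redwords_cat o a b (F : W -> nat) :
  \sum_(w <- redwords o (a + b)) F w =
  \sum_(u <- redwords o a) \sum_(v <- redwords (olast o u) b) F (u ++ v).
Proof.
elim: a o F => [|a IHa] o F; first by rewrite big_seq1.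
rewrite addSn !big_redwordsS; apply: eq_bigr => x _; rewrite IHa.
by apply: eq_bigr => u _; case: u.
Qed.

(** The longest common prefix has length exactly [j]; [ohead] compares the next letters without a
    default letter. *)
Definition branch j (r s : W) :=
  (take j r == take j s) && (ohead (drop j r) != ohead (drop j s)).

Lemma branchC j r s : branch j r s = branch j s r.
Proof. by rewrite /branch eq_sym [_ == ohead _]eq_sym. Qed.

(** * Deleting an occurrence of a fixed word *)

Section Deletion.
Variable z : W.
Local Notation B := (size z).+2.

Definition delete p (u : W) := take p u ++ drop (p + size z) u.

(* Requiring the shortened word to be reduced, and not merely to reduce, is what
   keeps the number of possible shortened words at 2m n^(l-|z|-1). *)
Definition deletable (u : W) p :=
  [&& 0 < p, p + size z < size u, take (size z) (drop p u) == z
    & sorted nocancel (delete p u)].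

(** Fixing the first position makes shortening a function of the word. If there is none, [find]
    returns [size u] and shortening leaves [u] unchanged. *)
Definition first_deletable u := find (deletable u) (iota 0 (size u)).

Definition shorten_word u := delete (first_deletable u) u.

Lemma has_deletable u p : deletable u p -> has (deletable u) (iota 0 (size u)).
Proof.
move=> up; apply/hasP; exists p => //; rewrite mem_iota /=.
by case/and4P: up => _ lt_p _ _; apply: leq_ltn_trans (leq_addr _ _) lt_p.
Qed.

Lemma first_deletableP u : has (deletable u) (iota 0 (size u)) ->
  deletable u (first_deletable u).
Proof.
move=> hu; have := nth_find 0 hu; rewrite nth_iota //.
by rewrite -[X in _ < X](size_iota 0) -has_find.
Qed.

Lemma delete_split u p : deletable u p ->
  u = take p u ++ z ++ drop (p + size z) u.
Proof.
case/and4P=> _ _ /eqP ez _; rewrite -{1}ez.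
by rewrite addnC -drop_drop !cat_take_drop.
Qed.

Lemma deletable_cat u p : deletable u p ->
  u = take p (delete p u) ++ z ++ drop p (delete p u).
Proof.
move=> up; have szp : size (take p u) = p.
  by apply: size_takel; case/and4P: up => _ lt_p _ _; lia.
by rewrite /delete take_size_cat // drop_size_cat // -delete_split.
Qed.

(** Deletion creates only one new adjacency, [c b], so [nocancel c b] keeps the word reduced. *)
Lemma deletable_decomp w1 c b w2 : sorted nocancel (w1 ++ c :: z ++ b :: w2) ->
  nocancel c b -> deletable (w1 ++ c :: z ++ b :: w2) (size w1).+1.
Proof.
move=> red cb; rewrite /deletable /delete -cat_rcons.
have sz1 : size (rcons w1 c) = (size w1).+1 by rewrite size_rcons.
have e : drop (size w1).+1 (rcons w1 c ++ z ++ b :: w2) = z ++ b :: w2.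
  by rewrite drop_size_cat.
rewrite [_ + size z]addnC -drop_drop e take_size_cat // drop_size_cat //.
rewrite take_size_cat // eqxx !size_cat sz1 /=.
apply/andP; split; first lia.
move: red; rewrite -cat_rcons.
case: w1 {sz1 e} => [|x w1] /=.
  by rewrite cat_path /= => /and3P[_ _ ->]; rewrite andbT.
rewrite !cat_path !rcons_path !last_rcons /=.
by rewrite cb => /andP[-> /and3P[_ _ ->]].
Qed.

Definition good_block (v : W) :=
  [exists c : L, [exists b : L, (v == c :: z ++ [:: b]) && nocancel c b]].

(** Only occurrences aligned with consecutive disjoint blocks are sought, so that they can be
    counted block by block. *)
Fixpoint good_blocks J (w : W) :=
  if J is J'.+1 then good_block (take B w) || good_blocks J' (drop B w) else false.

Lemma good_blocks_decomp J w : good_blocks J w ->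
  exists w1 c b w2, w = w1 ++ c :: z ++ b :: w2 /\ nocancel c b.
Proof.
elim: J w => //= J IHJ w /orP[/existsP[c /existsP[b /andP[/eqP e cb]]]|/IHJ].
  exists [::], c, b, (drop B w); split => //.
  by rewrite -[LHS](cat_take_drop B) e /= -catA.
move=> [w1 [c [b [w2 [e cb]]]]]; exists (take B w ++ w1), c, b, w2.
by rewrite -catA -e cat_take_drop.
Qed.

End Deletion.
End Words.

Arguments redwords {m} o l : simpl never.

(** * Counting branching pairs and words with a deletable occurrence *)

Section Counting.
Variable m : nat.
Hypothesis m_gt1 : 1 < m.
Local Notation L := (letter m).
Local Notation W := (word m).
Local Notation n := (2 * m - 1).

Lemma card_follows a : #|[pred x : L | follows (Some a) [:: x]]| = n.
Proof.
rewrite (eq_card (B := predC1 (linv a))); last by move=> x; rewrite !inE /= andbT.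
by rewrite cardC1 card_prod card_ord card_bool; lia.
Qed.

Lemma size_redwords (a : L) l : size (redwords (Some a) l) = n ^ l.
Proof.
elim: l a => // l IHl a; rewrite -sum1_size big_redwordsS.
under eq_bigr do rewrite sum1_size IHl.
by rewrite sum_nat_const card_follows expnS.
Qed.

Lemma size_redwords0 l : size (redwords (@None L) l.+1) = 2 * m * n ^ l.
Proof.
rewrite -sum1_size big_redwordsS.
under eq_bigr do rewrite sum1_size size_redwords.
by rewrite sum_nat_const card_prod card_ord card_bool; lia.
Qed.

(** The first [j] letters of [s] are forced, which leaves at most [n^(k+1)] tails. Conversely, fix a
    next letter compatible with the prefix and different from that of [r]; the other [k] letters
    give [n^k] tails. *)
Lemma branch_deg j k r : 0 < j -> r \in redwords (@None L) (j + k.+1) ->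
  n ^ k <= \sum_(s <- redwords (@None L) (j + k.+1)) branch j r s <= n ^ k.+1.
Proof.
move=> j0 rW; have szr := size_redwordsP rW.
have rj : take j r \in redwords (@None L) j.
  move: rW; rewrite !mem_redwords -{2}(cat_take_drop j r) follows_cat.
  by rewrite size_takel ?eqxx ?szr ?leq_addr // => /and3P[].
rewrite big_redwords_cat (bigD1_seq (take j r)) ?redwords_uniq //=.
rewrite [X in _ + X]big1_seq ?addn0 => [|u /andP[nu uj]]; last first.
  rewrite big1 // => v _; rewrite /branch take_size_cat ?(size_redwordsP uj) //.
  by rewrite eq_sym (negPf nu).
have [b lb] : exists b, olast None (take j r) = Some b.
  by case: (take j r) (size_redwordsP rj) j0 => [<-|x s _ _] //; exists (last x s).
rewrite lb; apply/andP; split; last first.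
  by rewrite -(size_redwords b) -sum1_size leq_sum // => v _; case: (branch _ _ _).
case er : (drop j r) => [|y r'].
  by have := size_drop j r; rewrite er szr /=; lia.
have [x] : exists x, x \notin [:: linv b; y] by apply: avoid_letters => /=; lia.
rewrite !inE negb_or => /andP[xb xy].
rewrite big_redwordsS (bigD1 x) /= ?andbT // -(size_redwords x) -sum1_size.
apply: leq_trans (leq_addr _ _).
apply: leq_sum => v _; rewrite /branch er.
by rewrite take_size_cat ?drop_size_cat ?(size_redwordsP rj) //= eqxx eq_sym lt0b.
Qed.

Variable z : W.
Hypotheses (z_nil : z != [::]) (z_red : sorted (@nocancel m) z).
Local Notation B := (size z).+2.

(** Each of [c] and [b] has only two letters to avoid. *)
Lemma good_block_exists (a : L) :
  exists c b, follows (Some a) (c :: z ++ [:: b]) /\ nocancel c b.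
Proof.
case: z z_nil z_red => [//|z1 z'] _ /= z_path.
have [c] : exists c, c \notin [:: linv a; linv z1] by apply: avoid_letters => /=; lia.
have [b] : exists b, b \notin [:: linv (last z1 z'); linv c].
  by apply: avoid_letters => /=; lia.
rewrite !inE !negb_or => /andP[zb cb] /andP[ac cz]; exists c, b; split => //.
have cz1 : nocancel c z1 by rewrite nocancelC.
by rewrite cat_path /= z_path cz1 /nocancel ac zb.
Qed.

(* Whatever letter precedes a block of |z|+2 letters, one of its n^(|z|+2)
   reduced fillings has the form c z b with b <> c^-1. *)
Lemma bad_block_count a :
  \sum_(v <- redwords (Some a) B) ~~ good_block z v <= (n ^ B).-1.
Proof.
have [c [b [red cb]]] := good_block_exists a.
have vB : c :: z ++ [:: b] \in redwords (Some a) B.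
  by rewrite mem_redwords red /= size_cat addn1 eqxx.
rewrite -(size_redwords a) -(sum1_size (redwords _ _)) !(big_rem _ vB) /=.
have -> : good_block z (c :: z ++ [:: b]).
  by apply/existsP; exists c; apply/existsP; exists b; rewrite eqxx.
rewrite add0n.
by apply: leq_sum => v _; case: good_block.
Qed.

(** The bound on one block holds for every preceding letter, so the bounds multiply as if the blocks
    were independent. *)
Lemma bad_blocks_count J a :
  \sum_(w <- redwords (Some a) (J * B)) ~~ good_blocks z J w <= (n ^ B).-1 ^ J.
Proof.
elim: J a => [|J IHJ] a; first by rewrite mul0n /= big_seq1.
rewrite mulSn big_redwords_cat expnS.
apply: leq_trans (_ : \sum_(v <- redwords (Some a) B)
   (~~ good_block z v) * (n ^ B).-1 ^ J <= _); last first.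
  by rewrite -big_distrl leq_mul2r bad_block_count orbT.
rewrite big_seq [leqRHS]big_seq; apply: leq_sum => v vB.
have szv := size_redwordsP vB.
have [b ->] : exists b, olast (Some a) v = Some b.
  by case: v szv {vB} => // x s _; exists (last x s).
apply: leq_trans (_ : (~~ good_block z v) *
  \sum_(w <- redwords (Some b) (J * B)) ~~ good_blocks z J w <= _); last first.
  by rewrite leq_mul2l IHJ orbT.
rewrite big_distrr leq_sum // => w _ /=.
by rewrite take_size_cat // drop_size_cat // negb_or mulnb.
Qed.

(** All blocks are bad for a proportion of at most [(1 - 1/n^B)^J <= 1/2] of the words. The letter
    removed by [behead] is the one preceding the first block; the last [e] letters are arbitrary. *)
Lemma deletable_half J e :  n ^ B <= J ->
  size (redwords (@None L) (J * B + e).+1) <=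
  2 * \sum_(u <- redwords (@None L) (J * B + e).+1) good_blocks z J (behead u).
Proof.
move=> YJ; set l := J * B + e; set S := \sum_(u <- _) _.
have tot : S + \sum_(u <- redwords (@None L) l.+1) ~~ good_blocks z J (behead u)
   = size (redwords (@None L) l.+1).
  by rewrite -big_split -sum1_size; apply: eq_bigr => u _ /=; case: good_blocks.
have cut u v : size u = J * B -> good_blocks z J (u ++ v) = good_blocks z J u.
  elim: J u {YJ l S tot} => // J IHJ u szu /=.
  have szB : B <= size u by rewrite szu mulSn leq_addr.
  have szB' : size (take B u) = B by rewrite size_takel.
  rewrite -{1 2}(cat_take_drop B u) -catA.
  rewrite take_size_cat // drop_size_cat // IHJ //.
  by rewrite size_drop szu mulSn addKn.
have bad : \sum_(u <- redwords (@None L) l.+1) ~~ good_blocks z J (behead u)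
    <= 2 * m * ((n ^ B).-1 ^ J * n ^ e).
  rewrite big_redwordsS /=.
  apply: leq_trans (_ : \sum_(x : L) (n ^ B).-1 ^ J * n ^ e <= _); last first.
    by rewrite sum_nat_const card_prod card_ord card_bool [m * 2]mulnC.
  apply: leq_sum => x _; rewrite big_redwords_cat.
  apply: leq_trans (leq_mul (bad_blocks_count J x) (leqnn _)).
  rewrite big_distrl /= big_seq [leqRHS]big_seq; apply: leq_sum => u uB.
  have [b ->] : exists b, olast (Some x) u = Some b.
    by case: u uB => [|y s] _; [exists x | exists (last y s)].
  rewrite -(size_redwords b) -sum1_size big_distrr leq_sum // => v _ /=.
  by rewrite muln1 cut // (size_redwordsP uB).
have n0 : 0 < n ^ B by rewrite expn_gt0; lia.
have := leq_mul (leqnn (2 * m * n ^ e)) (bernoulli n0 YJ).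
rewrite -expnM mulnC [B * J]mulnC.
move: tot; rewrite size_redwords0 /l expnD; move: bad; set Bad := \sum_(u <- _) _.
move=> /leP bad /esym tot /leP le; apply/leP; move: bad tot le.
rewrite -/l; set a := n ^ (J * B); set b := n ^ e; set c := _ ^ J; nia.
Qed.

End Counting.

(** * Pairs of words that differ only in z and in the last letter *)

Section Gluing.
Variable m : nat.
Variable z : word m.
Variables x y : letter m.
Local Notation L := (letter m).
Local Notation W := (word m).
Local Notation n := (2 * m - 1).
Local Notation B := (size z).+2.

(* The last two conditions say that [u] may be followed by [x] and by [y]. *)
Definition shortenable (u : W) :=
  [&& has (deletable z u) (iota 0 (size u)), nocancel (last x u) x
    & nocancel (last y u) y].

Lemma shorten_word_red l u : u \in redwords (@None L) l -> shortenable u ->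
  shorten_word z u \in redwords (@None L) (l - size z).
Proof.
move=> uW /and3P[/first_deletableP du _ _].
case/and4P: (du) => _ lt_p _ red; rewrite mem_redwords [follows _ _]red andbT.
rewrite /shorten_word /delete size_cat size_drop size_takel; last first.
  exact: leq_trans (leq_addr _ _) (ltnW lt_p).
move: lt_p; rewrite (size_redwordsP uW); set p := first_deletable z u.
by move=> lt_p; apply/eqP; lia.
Qed.

(* [u] is determined by the shortened word and the place of the deletion. *)
Lemma shorten_word_fiber l v :
  \sum_(u <- redwords (@None L) l) (shortenable u && (shorten_word z u == v)) <= l.
Proof.
rewrite -big_mkcond sum1_count -size_filter.
rewrite -[leqRHS](size_iota 0) -(size_map (fun p => take p v ++ z ++ drop p v)).
apply: uniq_leq_size; first by rewrite filter_uniq // redwords_uniq.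
move=> u; rewrite mem_filter => /andP[/andP[/and3P[hu _ _] /eqP<-] uW].
have du := first_deletableP hu; apply/mapP; exists (first_deletable z u).
  rewrite mem_iota /= -(size_redwordsP uW); case/and4P: du => _ lt_p _ _.
  exact: leq_ltn_trans (leq_addr _ _) lt_p.
exact: deletable_cat.
Qed.

Definition glued l (r s : W) :=
  [&& drop l r == [:: x], drop l s == [:: y], shortenable (take l r),
      shortenable (take l s) & shorten_word z (take l r) == shorten_word z (take l s)].

Lemma olast_shortenable u l : u \in redwords (@None L) l.+1 -> shortenable u ->
  [:: x] \in redwords (olast None u) 1 /\ [:: y] \in redwords (olast None u) 1.
Proof.
move=> uW /and3P[_ ux uy]; rewrite !mem_redwords /=.
by case: u uW ux uy => [/size_redwordsP//|a u] /= _ -> ->.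
Qed.

(** Cauchy-Schwarz over the fibres of shortening: since shortened words are few, many pairs [u],
    [u'] share one, and appending [x] and [y] makes each such pair a glued pair. *)
Lemma glued_count l :
  (\sum_(u <- redwords (@None L) l.+1) shortenable u) ^ 2 <=
  size (redwords (@None L) (l.+1 - size z)) *
  \sum_(r <- redwords (@None L) l.+2) \sum_(s <- redwords (@None L) l.+2) glued l.+1 r s.
Proof.
set V := redwords _ (l.+1 - _); set U := redwords _ l.+1.
pose a v := \sum_(u <- U) (shortenable u && (shorten_word z u == v)).
have sum_a : \sum_(u <- U) shortenable u = \sum_(v <- V) a v.
  rewrite exchange_big /= big_seq [RHS]big_seq; apply: eq_bigr => u uU.
  case: (boolP (shortenable u)) => su /=; last by rewrite big1.
  rewrite (bigD1_seq (shorten_word z u)) ?redwords_uniq ?shorten_word_red //=.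
  by rewrite eqxx big1 // => v; rewrite eq_sym => /negPf->.
have cauchy (s : seq W) : (\sum_(v <- s) a v) ^ 2 <= size s * \sum_(v <- s) a v ^ 2.
  elim: s => [|v s IHs]; first by rewrite !big_nil.
  rewrite !big_cons /=.
  have cross : 2 * a v * \sum_(v <- s) a v <= size s * a v ^ 2 + \sum_(v <- s) a v ^ 2.
    elim: s {IHs} => [|v' s IHs]; first by rewrite !big_nil; lia.
    rewrite !big_cons /=; have [le1 _] := nat_Cauchy (a v) (a v'); nia.
  nia.
rewrite sum_a; apply: leq_trans (cauchy V) _; rewrite leq_mul2l; apply/orP; right.
(* The squares of the fibre sizes count the pairs lying in a common fibre. *)
have -> : \sum_(v <- V) a v ^ 2 = \sum_(u <- U) \sum_(u' <- U)
    [&& shortenable u, shortenable u' & shorten_word z u == shorten_word z u'].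
  under eq_bigr do rewrite -mulnn {1}/a big_distrl.
  rewrite exchange_big /= big_seq [RHS]big_seq; apply: eq_bigr => u uU.
  case: (boolP (shortenable u)) => su /=; last by rewrite !big1.
  rewrite (bigD1_seq (shorten_word z u)) ?redwords_uniq ?shorten_word_red //=.
  rewrite eqxx mul1n big1 ?addn0 => [|v]; last by rewrite eq_sym => /negPf->.
  by apply: eq_bigr => u' _; rewrite eq_sym.
rewrite -[l.+2]addn1 big_redwords_cat.
rewrite big_seq [leqRHS]big_seq; apply: leq_sum => u uU.
have szu := size_redwordsP uU.
case: (boolP (shortenable u)) => su /=; last by rewrite big1.
apply: leq_trans (leq_sum_mem (x := [:: x]) _ _); last first.
  by have [] := olast_shortenable uU su.
rewrite big_redwords_cat big_seq [leqRHS]big_seq; apply: leq_sum => u' uU'.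
have szu' := size_redwordsP uU'.
case: (boolP (shortenable u')) => su' //=.
apply: leq_trans (leq_sum_mem (x := [:: y]) _ _); last first.
  by have [] := olast_shortenable uU' su'.
rewrite /glued !take_size_cat ?drop_size_cat //= su su' !eqxx /=.
by case: eqP.
Qed.

(** The word [s] ends in [y], and the rest of it lies in the fibre over the shortened prefix of
    [r]. *)
Lemma glued_degl l r :
  \sum_(s <- redwords (@None L) l.+2) glued l.+1 r s <= l.+1.
Proof.
rewrite -[l.+2]addn1 big_redwords_cat.
apply: leq_trans (shorten_word_fiber l.+1 (shorten_word z (take l.+1 r))).
rewrite big_seq [leqRHS]big_seq; apply: leq_sum => u uU.
have szu := size_redwordsP uU.
case: (boolP (_ && _)) => [/andP[su /eqP eu]|nsu].
  have [_ yU] := olast_shortenable uU su.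
  rewrite (bigD1_seq [:: y]) ?redwords_uniq //= big1 ?addn0 ?leq_b1 // => v /negPf vy.
  by rewrite /glued drop_size_cat // vy andbF.
rewrite big1 // => v _; rewrite /glued take_size_cat //.
by case/nandP: nsu => /negPf h; rewrite ?[_ == shorten_word z u]eq_sym h ?andbF.
Qed.

Lemma glued_degr l s :
  \sum_(r <- redwords (@None L) l.+2) glued l.+1 r s <= l.+1.
Proof.
rewrite -[l.+2]addn1 big_redwords_cat.
apply: leq_trans (shorten_word_fiber l.+1 (shorten_word z (take l.+1 s))).
rewrite big_seq [leqRHS]big_seq; apply: leq_sum => u uU.
have szu := size_redwordsP uU.
case: (boolP (_ && _)) => [/andP[su /eqP eu]|nsu].
  have [xU _] := olast_shortenable uU su.
  rewrite (bigD1_seq [:: x]) ?redwords_uniq //= big1 ?addn0 ?leq_b1 // => v /negPf vx.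
  by rewrite /glued drop_size_cat // vx.
rewrite big1 // => v _; rewrite /glued take_size_cat //.
by case/nandP: nsu => /negPf->; rewrite ?andbF.
Qed.

Hypotheses (m_gt1 : 1 < m) (z_nil : z != [::]) (z_red : sorted (@nocancel m) z).

(** To a word with a good block append a letter [t] avoiding the inverses of its last letter, of [x]
    and of [y]. Each such word thus has a shortenable extension. *)
Lemma shortenable_count J e : n ^ B <= J ->
  size (redwords (@None L) (J * B + e).+1) <=
  2 * \sum_(u <- redwords (@None L) (J * B + e).+2) shortenable u.
Proof.
move=> YJ; apply: leq_trans (deletable_half m_gt1 z_nil z_red e YJ) _.
rewrite leq_mul2l /= -[(J * B + e).+2]addn1 big_redwords_cat.
rewrite big_seq [leqRHS]big_seq; apply: leq_sum => u uW.
case: (boolP (good_blocks _ _ _)) => // /good_blocks_decomp.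
move: uW; rewrite mem_redwords; case: u => [|a u] //= /andP[_ red].
move=> [w1 [c [b [w2 [eu cb]]]]].
have [t] : exists t, t \notin [:: linv (last a u); linv x; linv y].
  by apply: avoid_letters => /=; lia.
rewrite !inE !negb_or => /and3P[at_ tx ty].
have red' : sorted (@nocancel m) ((a :: w1) ++ c :: z ++ b :: rcons w2 t).
  rewrite -rcons_cons -!rcons_cat -rcons_cons -rcons_cat /= -eu rcons_path red /=.
  exact: at_.
have tx' : nocancel t x by rewrite nocancelC.
have ty' : nocancel t y by rewrite nocancelC.
have short : shortenable (rcons (a :: u) t).
  rewrite /shortenable !last_rcons tx' ty' !andbT.
  apply: (has_deletable (p := (size (a :: w1)).+1)).
  have := deletable_decomp red' cb.
  by rewrite -rcons_cons -!rcons_cat -rcons_cons -rcons_cat cat_cons -eu.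
apply: leq_trans (leq_sum_mem (x := [:: t]) _ _); last first.
  by rewrite mem_redwords /= andbT; apply: at_.
by rewrite /= cats1 -rcons_cons short.
Qed.

End Gluing.

(** * Collapse of the presented group *)

Section Presented.
Variables (m : nat) (Rs : seq (word m)).
Local Notation "u ~~> v" := (wrel Rs u v) (at level 70).

Lemma wrel_cat u u' v v' : u ~~> u' -> v ~~> v' -> u ++ v ~~> u' ++ v'.
Proof.
move=> uu vv; apply: (@wrel_trans _ _ _ (u' ++ v)).
  elim: uu v {v' vv} => [w|w w' _ IH|w1 w2 w3 _ IH1 _ IH2|w1 w2 x|w1 w2 r rR] v.
  - exact: wrel_refl.
  - exact/wrel_sym/IH.
  - exact: wrel_trans (IH1 v) (IH2 v).
  - by rewrite -!catA /=; apply: wrel_cancel.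
  - by rewrite -!catA; apply: wrel_rel.
elim: vv {u uu} => [w|w w' _ IH|w1 w2 w3 _ IH1 _ IH2|w1 w2 x|w1 w2 r rR].
- exact: wrel_refl.
- exact/wrel_sym/IH.
- exact: wrel_trans IH1 IH2.
- by rewrite !catA; apply: wrel_cancel.
- by rewrite !(catA u'); apply: wrel_rel.
Qed.

Lemma relator_trivial r : r \in Rs -> r ~~> [::].
Proof. by move=> rR; have := wrel_rel [::] [::] rR; rewrite cats0. Qed.

Definition winv (w : word m) := rev [seq linv x | x <- w].

Lemma winv_mul w : winv w ++ w ~~> [::].
Proof.
elim: w => [|x w IHw]; first exact: wrel_refl.
rewrite /winv /= rev_cons cat_rcons; apply: wrel_trans IHw.
by have := wrel_cancel Rs (winv w) w (linv x); rewrite linvK.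
Qed.

Lemma wrel_cancel_left u v w : u ++ v ~~> u ++ w -> v ~~> w.
Proof.
move=> uvw.
have step t : t ~~> winv u ++ (u ++ t).
  by rewrite catA; apply/wrel_sym/(wrel_cat (winv_mul u) (wrel_refl _ t)).
apply: wrel_trans (step v) _; apply: wrel_trans (wrel_sym (step w)).
exact: wrel_cat (wrel_refl _ _) uvw.
Qed.

(** Only the junction matters. The induction moves the letters of [c :: u] one by one, inverted, to
    the front of [v]. *)
Lemma winv_cat_sorted c u v : path (@nocancel m) c u ->
  sorted (@nocancel m) (linv c :: v) -> sorted (@nocancel m) (winv (c :: u) ++ v).
Proof.
elim: u c v => [|c' u IHu] c v //= /andP[cc' cu] cv.
rewrite /winv map_cons rev_cons cat_rcons; apply: IHu => //=; rewrite cv andbT.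
by rewrite /nocancel (can_eq (@linvK m)); rewrite nocancelC in cc'.
Qed.

(** Cancelling the common prefix makes the two tails equal in the group. The inverse of one followed
    by the other is reduced because they start with different letters. *)
Lemma branch_trivial j k r s : r \in Rs -> s \in Rs ->
  r \in redwords None (j + k.+1) -> s \in redwords None (j + k.+1) ->
  branch j r s ->
  exists z, [/\ size z = 2 * k.+1, sorted (@nocancel m) z & z ~~> [::]].
Proof.
move=> rR sR; rewrite !mem_redwords => /andP[/eqP szr redr] /andP[/eqP szs reds].
case/andP=> /eqP e nh; exists (winv (drop j r) ++ drop j s).
have szdr : size (drop j r) = k.+1 by rewrite size_drop szr addKn.
have szds : size (drop j s) = k.+1 by rewrite size_drop szs addKn.
have : sorted (@nocancel m) (drop j r) by apply: drop_sorted.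
have : sorted (@nocancel m) (drop j s) by apply: drop_sorted.
have rs : drop j r ~~> drop j s.
  apply: (@wrel_cancel_left (take j r)); rewrite {2}e !cat_take_drop.
  exact: wrel_trans (relator_trivial rR) (wrel_sym (relator_trivial sR)).
move=> reds' redr'; split.
- by rewrite size_cat size_rev size_map szdr szds mul2n addnn.
- case: (drop j r) (drop j s) nh szdr szds redr' reds' {rs} => [|c u] [|d v] //= cd _ _.
  move=> cu dv; apply: winv_cat_sorted => //=; rewrite dv andbT.
  by rewrite /nocancel linvK eq_sym; apply: contraNneq cd => ->.
- apply: wrel_trans (winv_mul (drop j r)).
  exact: wrel_cat (wrel_refl _ _) (wrel_sym rs).
Qed.

Lemma shorten_word_rel z u : z ~~> [::] ->
  has (deletable z u) (iota 0 (size u)) -> u ~~> shorten_word z u.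
Proof.
move=> z1 /first_deletableP /delete_split e; rewrite {1}e /shorten_word /delete.
apply: wrel_cat (wrel_refl _ _) _.
exact: (wrel_cat z1 (wrel_refl _ _)).
Qed.

(** The relators become the common shortened word followed by [x] and by [y]; that word cancels. *)
Lemma glued_rel z x y l r s : z ~~> [::] -> r \in Rs -> s \in Rs ->
  glued z x y l r s -> [:: x] ~~> [:: y].
Proof.
move=> z1 rR sR /and5P[/eqP ex /eqP ey /and3P[hr _ _] /and3P[hs _ _] /eqP e].
apply: (@wrel_cancel_left (shorten_word z (take l r))).
have side t c : t \in Rs -> drop l t = [:: c] ->
    has (deletable z (take l t)) (iota 0 (size (take l t))) ->
    shorten_word z (take l t) ++ [:: c] ~~> [::].
  move=> tR et ht; apply: wrel_trans (relator_trivial tR).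
  rewrite -{2}(cat_take_drop l t) et.
  exact: wrel_cat (wrel_sym (shorten_word_rel z1 ht)) (wrel_refl _ _).
apply: wrel_trans (side _ _ rR ex hr) _; rewrite e.
exact: wrel_sym (side _ _ sR ey hs).
Qed.

Section Collapse.
Hypothesis letters_eq : forall x y : letter m, [:: x] ~~> [:: y].
Hypothesis m_gt0 : 0 < m.
Let x0 : letter m := (Ordinal m_gt0, false).

(** A letter also equals its own inverse, so [x0 x0] is trivial and only the parity of the length
    survives. *)
Lemma word_parity w : w ~~> nseq (odd (size w)) x0.
Proof.
elim: w => [|x w IHw] /=; first exact: wrel_refl.
apply: wrel_trans (wrel_cat (letters_eq x x0) IHw) _.
case: (odd _) => /=; last exact: wrel_refl.
apply: wrel_trans (wrel_cat (wrel_refl _ [:: x0]) (letters_eq x0 (linv x0))) _.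
exact: (wrel_cancel Rs [::] [::] x0).
Qed.

(** A relator of odd length kills [x0]. If all lengths are even, parity of length defines a map onto
    Z/2, injective by [word_parity]. *)
Lemma presented_iso_small :
  presented_iso Rs trivial_grp \/ presented_iso Rs Z2_grp.
Proof.
case: (boolP (has (fun r => odd (size r)) Rs)) => [/hasP[r rR odd_r]|no_odd].
  left; exists (fun=> 1%g); split.
  - by move=> s _; apply/val_inj; case: (eval_word _ s) => -[].
  - by move=> h; exists [::]; apply/val_inj; case: h => -[].
  - move=> w _; apply: wrel_trans (word_parity w) _; case: (odd _); last exact: wrel_refl.
    apply: wrel_trans (relator_trivial rR); apply: wrel_sym.
    by have := word_parity r; rewrite odd_r.
right; pose phi (_ : 'I_m) : Z2_grp := inord 1.
have evalE w : eval_word phi w = inord (odd (size w)).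
  elim: w => [|x w IHw] /=.
    by apply/val_inj; rewrite /= inordK.
  rewrite IHw /eval_letter; apply/val_inj; case: x.2; case: (odd _);
  by rewrite /= ?inordK.
exists phi; split.
- move=> r rR; rewrite evalE.
  move/hasPn: no_odd => /(_ r rR) /negPf ->; by apply/val_inj; rewrite /= inordK.
- move=> h; exists (nseq h x0); rewrite evalE size_nseq.
  by apply/val_inj; case: h => -[|[|]] //= _; rewrite inordK.
- move=> w; rewrite evalE => /(congr1 val) /=; rewrite inordK ?ltnS ?leq_b1 // => e.
  by have := word_parity w; rewrite e.
Qed.

End Collapse.
End Presented.

(** Lets a relation deduced from two relators persist once the others are drawn. *)
Lemma wrel_sub m (Rs Rs' : seq (word m)) u v :
  {subset Rs <= Rs'} -> wrel Rs u v -> wrel Rs' u v.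
Proof.
move=> sub; elim=> [w|w w' _ IH|w1 w2 w3 _ IH1 _ IH2|w1 w2 x|w1 w2 r rR].
- exact: wrel_refl.
- exact: wrel_sym.
- exact: wrel_trans IH1 IH2.
- exact: wrel_cancel.
- exact/wrel_rel/sub.
Qed.

(** * Failure probabilities *)

Section Assembly.
Import Order.TTheory GRing.Theory Num.Theory.
Local Open Scope ring_scope.
Variables (F : realFieldType) (m k J e q : nat).
Hypotheses (m_gt1 : (1 < m)%N) (q_gt0 : (0 < q)%N).
Local Notation n := (2 * m - 1)%N.
Local Notation B := (2 * k.+1).+2.
Hypothesis J_ge : (n ^ B <= J)%N.
(** Three letters are added to the blocks and the remainder [e]: the one before the first block, the
    letter [t] appended in [shortenable_count], and the final [x] or [y]. *)
Local Notation l := (J * B + e).+3.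
Local Notation W := (redwords (@None (letter m)) l).

Let n_gt0 : (0 < n)%N. Proof. lia. Qed.
Let J_gt0 : (0 < J)%N. Proof. by apply: leq_trans J_ge; rewrite expn_gt0 n_gt0. Qed.
Let kl : (B <= l)%N. Proof. by have := leq_pmull B J_gt0; lia. Qed.

Let sizeW : size W = (2 * m * n ^ l.-1)%N.
Proof. exact: size_redwords0. Qed.

Let W_gt0 : (0 < size W)%N.
Proof. by rewrite sizeW muln_gt0 expn_gt0 n_gt0 andbT; lia. Qed.

Lemma avg_nat (T : eqType) (V : seq T) (g : T -> nat) :
  avg V (fun s => (g s)%:R) = (\sum_(s <- V) g s)%:R / (size V)%:R :> F.
Proof. by rewrite /avg natr_sum. Qed.

(** The bound of [collision] with [p = n^k / |W|] and [d = n^(k+1) / |W|]. *)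
Definition branch_error : F := (size W)%:R / (q%:R ^+ 2 * n%:R ^+ k) + 2 * n%:R / q%:R.

Lemma branch_prob : Exp W q (fun g => Exp W q (fun h =>
  (~~ has (fun r => has (branch (l - k.+1) r) h) g)%:R)) <= branch_error.
Proof.
have j0 : (0 < l - k.+1)%N by lia.
have el : l = (l - k.+1 + k.+1)%N by lia.
have deg r : r \in W -> (n ^ k <= \sum_(s <- W) branch (l - k.+1) r s <= n ^ k.+1)%N.
  by move=> rW; have := branch_deg m_gt1 j0 (k := k) (r := r); rewrite -el; apply.
have M0 : 0 < (size W)%:R :> F by rewrite ltr0n.
have n0 : 0 < n%:R :> F by rewrite ltr0n.
have q0 : 0 < q%:R :> F by rewrite ltr0n.
pose p : F := n%:R ^+ k / (size W)%:R; pose d : F := n%:R ^+ k.+1 / (size W)%:R.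
have dl : {in W, forall r, avg W (fun s => (branch (l - k.+1) r s)%:R) <= d}.
  move=> r rW; rewrite avg_nat ler_wpM2r ?invr_ge0 ?ler0n // -natrX ler_nat.
  by case/andP: (deg r rW).
have dr : {in W, forall s, avg W (fun r => (branch (l - k.+1) r s)%:R) <= d}.
  move=> s sW; apply: le_trans (dl s sW); rewrite le_eqVlt; apply/orP; left.
  by apply/eqP/eq_avg => r; rewrite branchC.
have pp : p <= avg W (fun r => avg W (fun s => (branch (l - k.+1) r s)%:R)).
  rewrite -[leLHS](avg_cst W_gt0); apply: le_avg => r rW.
  rewrite avg_nat ler_wpM2r ?invr_ge0 ?ler0n // -natrX ler_nat.
  by case/andP: (deg r rW).
have p0 : 0 < p by rewrite divr_gt0 ?exprn_gt0.
apply: le_trans (collision W_gt0 q_gt0 p0 pp dl dr) _.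
rewrite le_eqVlt; apply/orP; left; apply/eqP.
have nk0 : 0 < n%:R ^+ k :> F by apply: exprn_gt0.
rewrite /branch_error /p /d [_ ^+ k.+1]exprS; move: M0 n0 q0 nk0.
move: (size W)%:R n%:R q%:R (_ ^+ k) => M a b nk M0 a0 b0 nk0.
by field; rewrite !lt0r_neq0.
Qed.

Section Glue.
Variable z : word m.
Hypotheses (z_size : size z = (2 * k.+1)%N) (z_red : sorted (@nocancel m) z).
Variables x y : letter m.
Local Notation v := (2 * m * n ^ (l - B))%N.

(** The bound of [collision] with [p = 1 / (4 n^4 v)] and [d = l / |W|], simplified by [v <= |W|].
    Here [v] is the number of reduced words of the shortened length. *)
Definition glue_error : F :=
  4 * n%:R ^+ 4 * v%:R / q%:R ^+ 2 + 8 * n%:R ^+ 4 * l%:R / q%:R.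

Lemma glue_prob : Exp W q (fun g => Exp W q (fun h =>
  (~~ has (fun r => has (glued z x y l.-1 r) h) g)%:R)) <= glue_error.
Proof.
have z_nil : z != [::] by rewrite -size_eq0 z_size.
set T := (\sum_(r <- W) \sum_(s <- W) glued z x y l.-1 r s)%N.
have M0 : 0 < (size W)%:R :> F by rewrite ltr0n.
have n0 : 0 < n%:R :> F by rewrite ltr0n.
have q0 : 0 < q%:R :> F by rewrite ltr0n.
have v_gt0 : (0 < v)%N by rewrite muln_gt0 expn_gt0 n_gt0 andbT; lia.
have v0 : 0 < v%:R :> F by rewrite ltr0n.
(* Relators are two letters longer than the words with a good block, which costs [n^2]; keeping only
   half of those costs 2. Counting pairs squares both factors. *)
have count : (size W ^ 2 <= 4 * n ^ 4 * v * T)%N.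
  have := glued_count z x y (J * B + e).+1.
  have := @shortenable_count m z x y m_gt1 z_nil z_red J e.
  rewrite z_size => /(_ J_ge); set S := (\sum_(u <- _) _)%N.
  have -> : ((J * B + e).+2 - 2 * k.+1 = (l - B).+1)%N by have := leq_pmull B J_gt0; lia.
  rewrite !(size_redwords0 m_gt1) -/T => le1 le2.
  have -> : (2 * m * n ^ (J * B + e).+2 = n ^ 2 * (2 * m * n ^ (J * B + e)))%N.
    by rewrite [RHS]mulnCA -expnD.
  have -> : (4 * n ^ 4 * v * T = n ^ 4 * (2 ^ 2 * (v * T)))%N by rewrite (mulnC 4) -!mulnA.
  rewrite expnMn -expnM leq_mul2l; apply/orP; right.
  apply: leq_trans (_ : (2 * S) ^ 2 <= _)%N; first by rewrite leq_exp2r.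
  by rewrite expnMn leq_mul2l.
pose p : F := (4 * n%:R ^+ 4 * v%:R)^-1; pose d : F := l%:R / (size W)%:R.
have dl : {in W, forall r, avg W (fun s => (glued z x y l.-1 r s)%:R) <= d}.
  move=> r rW; rewrite avg_nat ler_wpM2r ?invr_ge0 ?ler0n // ler_nat.
  by apply: leqW; apply: glued_degl.
have dr : {in W, forall s, avg W (fun r => (glued z x y l.-1 r s)%:R) <= d}.
  move=> r rW; rewrite avg_nat ler_wpM2r ?invr_ge0 ?ler0n // ler_nat.
  by apply: leqW; apply: glued_degr.
have p0 : 0 < p by rewrite invr_gt0 !mulr_gt0 ?exprn_gt0.
have pp : p <= avg W (fun r => avg W (fun s => (glued z x y l.-1 r s)%:R)).
  rewrite (eq_avg _ (fun r => avg_nat _ _)) /avg -mulr_suml -natr_sum -/T -mulrA -invfM.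
  rewrite /p ler_pdivlMr ?mulr_gt0 // ler_pdivrMl ?mulr_gt0 ?exprn_gt0 //.
  by rewrite -natrX -!natrM ler_nat mulnn.
apply: le_trans (collision W_gt0 q_gt0 p0 pp dl dr) _.
have vW : v%:R <= (size W)%:R :> F.
  by rewrite ler_nat sizeW leq_mul2l leq_pexp2l ?orbT // ; lia.
have -> : (q%:R ^+ 2 * p)^-1 + 2 * d / (q%:R * p) = 4 * n%:R ^+ 4 * v%:R / q%:R ^+ 2
   + 8 * n%:R ^+ 4 * l%:R / q%:R * (v%:R / (size W)%:R).
  rewrite /p /d; move: M0 n0 q0 v0.
  move: (size W)%:R n%:R q%:R v%:R l%:R => M a b c d' M0 a0 b0 c0.
  by field; rewrite !lt0r_neq0.
rewrite lerD2l ler_piMr //; last by rewrite ler_pdivrMr // mul1r.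
by rewrite !mulr_ge0 ?invr_ge0 ?ler0n // exprn_ge0 // ltW.
Qed.
End Glue.

Definition collapses (Rs : seq (word m)) : bool :=
  pb (presented_iso Rs trivial_grp \/ presented_iso Rs Z2_grp).

Lemma pbP (P : Prop) : reflect P (pb P).
Proof. by rewrite /pb; case: excluded_middle_informative => h; constructor. Qed.

(** Union bound over ordered pairs of letters: if every pair is glued, all letters are equal in the
    group. *)
Lemma not_collapses_glued Rs z : wrel Rs z [::] -> (~~ collapses Rs)%:R <=
  \sum_(xy : letter m * letter m)
    (~~ has (fun r => has (glued z xy.1 xy.2 l.-1 r) Rs) Rs)%:R :> F.
Proof.
move=> z1; case: (boolP (collapses Rs)) => [_|nc] /=.
  by apply: sumr_ge0 => xy _; apply: ler0n.
case: (boolP [forall xy : letter m * letter m,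
    has (fun r => has (glued z xy.1 xy.2 l.-1 r) Rs) Rs]) => [/forallP all_glued|].
  case/negP: nc; apply/pbP; apply: (presented_iso_small _ (ltnW m_gt1)) => x y.
  have /hasP[r rR /hasP[s sR]] := all_glued (x, y); exact: glued_rel.
rewrite negb_forall => /existsP[xy nxy]; rewrite (bigD1 xy) //= nxy lerDl.
by apply: sumr_ge0 => *; apply: ler0n.
Qed.

(** Condition on the first two batches. A branching pair in them determines a [z] that is
    independent of the next two batches, so [glue_prob] applies to each of the [(2m)^2] pairs of
    letters. *)
Lemma collapse_prob N : (4 * q <= N)%N ->
  Exp W N (fun Rs => (~~ collapses Rs)%:R) <=
  branch_error + (2 * m)%:R ^+ 2 * glue_error.
Proof.
move=> leN.
have -> : N = (q + (q + (q + (q + (N - 4 * q)))))%N by lia.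
have glue0 : 0 <= glue_error.
  by rewrite addr_ge0 ?mulr_ge0 ?invr_ge0 ?exprn_ge0 ?ler0n.
have C0 : 0 <= (2 * m)%:R ^+ 2 * glue_error by rewrite mulr_ge0 ?exprn_ge0 ?ler0n.
rewrite Exp_cat (eq_Exp _ _ (fun g1 => Exp_cat _ _ _ _)).
apply: le_trans (_ : Exp W q (fun g => Exp W q (fun h =>
  (~~ has (fun r => has (branch (l - k.+1) r) h) g)%:R + (2 * m)%:R ^+ 2 * glue_error)) <= _); last first.
  rewrite (eq_Exp _ _ (fun g => ExpD _ _ _ _)) ExpD.
  by rewrite (eq_Exp _ _ (fun g => Exp_cst W_gt0 _ _)) Exp_cst // lerD2r branch_prob.
apply: le_Exp => g _ gW; apply: le_Exp => h _ hW.
case: (boolP (has _ g)) => [/hasP[r rg /hasP[s sh brs]]|_]; last first.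
  (* Without a branching pair, the conditional failure probability is bounded by 1. *)
  apply: le_trans (_ : Exp W (q + (q + (N - 4 * q))) (fun=> 1) <= _).
    by apply: le_Exp => *; case: (~~ _).
  by rewrite Exp_cst //= lerDl.
rewrite add0r; have el : l = (l - k.+1 + k.+1)%N by lia.
have [rW sW] : r \in W /\ s \in W by split; [apply: gW | apply: hW].
rewrite el in rW sW.
(* The word [z] is already trivial in the group presented by [r] and [s] alone. *)
have [z [szz redz z1]] :=
  branch_trivial (mem_head r [:: s]) (mem_last r [:: s]) rW sW brs.
set rest := (N - 4 * q)%N.
pose no_pair xy g' h' := ~~ has (fun r => has (glued z xy.1 xy.2 l.-1 r) h') g'.
apply: le_trans (_ : \sum_(xy : letter m * letter m)
   Exp W q (fun g' => Exp W q (fun h' => (no_pair xy g' h')%:R)) <= _).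
  rewrite -(Exp_sum W_gt0) Exp_cat; apply: le_Exp => g' _ _.
  rewrite -(Exp_sum W_gt0) Exp_cat; apply: le_Exp => h' _ _.
  (* A glued pair within [g'] and [h'] is one within all of [Rs]; the relators outside the four
     batches are averaged out. *)
  rewrite -[leRHS](Exp_cst W_gt0 rest); apply: le_Exp => t _ _.
  set Rs := g ++ _.
  have Rs_z : wrel Rs z [::].
    apply: wrel_sub z1 => r'; rewrite !inE /Rs !mem_cat => /orP[/eqP->|/eqP->].
      by rewrite rg.
    by rewrite sh orbT.
  apply: le_trans (not_collapses_glued Rs_z) _.
  apply: ler_sum => xy _; rewrite ler_nat /no_pair.
  case: (boolP (has _ g')) => [|_]; last by rewrite leq_b1.
  case/hasP=> r' r'g' /hasP[s' s'h' gl]; rewrite leqn0 eqb0 negbK.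
  apply/hasP; exists r'; first by rewrite /Rs !mem_cat r'g' !orbT.
  by apply/hasP; exists s'; rewrite // /Rs !mem_cat s'h' !orbT.
apply: le_trans (_ : \sum_(xy : letter m * letter m) glue_error <= _).
  by apply: ler_sum => xy _; apply: glue_prob.
by rewrite sumr_const !card_prod card_ord card_bool -[glue_error *+ _]mulr_natl -natrX mulnn [(m * 2)%N]mulnC.
Qed.
End Assembly.

(** * Random presentations as independent draws *)

Section Sampling.
Import Order.TTheory GRing.Theory Num.Theory.
Local Open Scope ring_scope.
Variables (m l : nat).
Local Notation S := (l.-tuple (letter m))%type.
Local Notation W := (redwords (@None (letter m)) l).

Definition count_samples N (P : seq (word m) -> bool) : nat :=
  (\sum_(t : sample m l N | admissible t) P (relators t))%N.

Definition sample_cons N (st : S * sample m l N) : sample m l N.+1 :=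
  [ffun i => if unlift ord0 i is Some j then st.2 j else st.1].

Lemma sample_cons_bij N : bijective (@sample_cons N).
Proof.
exists (fun t : sample m l N.+1 => (t ord0, [ffun j => t (lift ord0 j)])) => [[s t]|t].
  congr (_, _); first by rewrite ffunE unlift_none.
  by apply/ffunP => j; rewrite !ffunE liftK.
by apply/ffunP => i; rewrite ffunE /=; case: unliftP => [j|] -> //; rewrite ffunE.
Qed.

Lemma relators_cons N (st : S * sample m l N) :
  relators (sample_cons st) = tval st.1 :: relators st.2.
Proof.
rewrite /relators enum_ordSl /= ffunE unlift_none -map_comp; congr (_ :: _).
by apply: eq_map => j /=; rewrite ffunE liftK.
Qed.

Lemma admissible_cons N (st : S * sample m l N) :
  admissible (sample_cons st) = freely_reduced (tval st.1) && admissible st.2.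
Proof.
apply/forallP/andP => [h|[h1 /forallP h2] i].
  split; first by have := h ord0; rewrite ffunE unlift_none.
  by apply/forallP => j; have := h (lift ord0 j); rewrite ffunE liftK.
by rewrite ffunE; case: unliftP => [j _|_] //; apply: h2.
Qed.

Lemma big_reduced_tuples (G : word m -> nat) :
  (\sum_(s : S | freely_reduced (tval s)) G s = \sum_(w <- W) G w)%N.
Proof.
pose V := [seq tval s | s <- [seq s <- enum {: S} | freely_reduced (tval s)]].
have VW : perm_eq V W; last first.
  by rewrite -(perm_big _ VW) big_map big_filter big_enum_cond.
apply: uniq_perm; first by rewrite (map_inj_uniq val_inj) filter_uniq ?enum_uniq.
  exact: redwords_uniq.
move=> w; rewrite mem_redwords; apply/mapP/andP => [[s]|[sz red]].
  by rewrite mem_filter => /andP[red _] ->; rewrite size_tuple.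
by exists (Tuple sz) => //; rewrite mem_filter mem_enum andbT; apply: red.
Qed.

Lemma count_samplesS N P :
  count_samples N.+1 P = (\sum_(w <- W) count_samples N (fun Rs => P (w :: Rs)))%N.
Proof.
rewrite /count_samples (reindex _ (onW_bij _ (@sample_cons_bij N))) /=.
under eq_bigl do rewrite admissible_cons.
under eq_bigr do rewrite relators_cons.
rewrite -(pair_big (fun s : S => freely_reduced (tval s)) (fun t => admissible t)
  (fun s t => nat_of_bool (P (tval s :: relators t)))) /=.
exact: (big_reduced_tuples (fun w => count_samples N (fun Rs => P (w :: Rs)))).
Qed.

(** Links the counting definition of probability to [Exp]: peeling off the first relator contributes
    one average and one factor [|W|]. *)
Lemma count_samplesE (F : realFieldType) N P : (0 < size W)%N ->
  (count_samples N P)%:R = (size W)%:R ^+ N * Exp W N (fun Rs => (P Rs)%:R) :> F.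
Proof.
move=> W_gt0; have W0 : (size W)%:R != 0 :> F by rewrite pnatr_eq0 -lt0n.
elim: N P => [|N IHN] P.
  have adm0 (t : sample m l 0) : admissible t = true by apply/forallP => -[].
  rewrite /= mul1r /count_samples (eq_bigl _ _ adm0).
  rewrite (eq_bigr (fun=> nat_of_bool (P [::]))) => [|t _]; last first.
    by congr (nat_of_bool (P _)); apply: size0nil; rewrite size_map size_enum_ord.
  by rewrite sum_nat_const card_ffun card_ord expn0 mul1n.
rewrite count_samplesS natr_sum; under eq_bigr do rewrite IHN.
rewrite -mulr_sumr /= /avg exprSr -mulrA; congr (_ * _).
by rewrite [RHS]mulrC divfK.
Qed.

End Sampling.

(** * Explicit lower bound for the probability of collapse *)

Section Bound.
Import Order.TTheory GRing.Theory Num.Theory.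
Local Open Scope ring_scope.
Variable m : nat.
Hypothesis m_gt1 : (1 < m)%N.
Local Notation n := (2 * m - 1)%N.

(** The part [2 + 2n] covers [branch_error]; [32 m^2 n^4] is [(2m)^2] times the factor [8 n^4]
    arising from [glue_error]. *)
Definition bound_const : R := (2 + 2 * n%:R + 32 * m%:R ^+ 2 * n%:R ^+ 4)%R.

Lemma prob_H_bound (f : nat -> R) l k q (B := (2 * k.+1).+2) :
  (n ^ B * B + 3 <= l)%N -> (0 < q)%N -> (4 * q <= nrel m f l)%N ->
  1 - bound_const * (n%:R ^+ l / (n%:R ^+ k * q%:R ^+ 2) + l%:R / q%:R) <=
  prob_H f (fun Rs : seq (word m) =>
     presented_iso Rs trivial_grp \/ presented_iso Rs Z2_grp) l <= 1.
Proof.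
move=> l_ge q_gt0 leN; set N := nrel m f l in leN *.
have n_gt0 : (0 < n)%N by lia.
pose J := ((l - 3) %/ B)%N; pose e := ((l - 3) %% B)%N.
have J_ge : (n ^ B <= J)%N by rewrite leq_divRL //; lia.
have el : l = (J * B + e).+3 by rewrite -divn_eq; lia.
have n0 : 0 < n%:R :> R by rewrite ltr0n.
have n1 : 1 <= n%:R :> R by rewrite ler1n.
have q0 : 0 < q%:R :> R by rewrite ltr0n.
have sizeW : size (redwords (@None (letter m)) l) = (2 * m * n ^ l.-1)%N.
  by rewrite el size_redwords0.
have W_gt0 : (0 < size (redwords (@None (letter m)) l))%N.
  by rewrite sizeW muln_gt0 expn_gt0 n_gt0 andbT; lia.
pose P := @collapses m.
have probE : prob_H f (fun Rs : seq (word m) =>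
     presented_iso Rs trivial_grp \/ presented_iso Rs Z2_grp) l =
     Exp (redwords (@None (letter m)) l) N (fun Rs => (P Rs)%:R).
  have cardE (Q : seq (word m) -> bool) :
      #|[set t : sample m l N | admissible t && Q (relators t)]| = count_samples l N Q.
    rewrite -sum1_card /count_samples big_mkcond [RHS]big_mkcond.
    by apply: eq_bigr => t _; rewrite inE; case: admissible; case: (Q _).
  transitivity (((count_samples l N P)%:R / (@count_samples m l N xpredT)%:R)%R : R).
    rewrite /prob_H -!cardE -!INRE RdivE; congr (_ / INR _).
    by apply: eq_card => t; rewrite !inE andbT.
  rewrite !count_samplesE // Exp_cst // mulr1 [LHS]mulrC mulKf // expf_neq0 //.
  by rewrite pnatr_eq0 -lt0n.
have compl : Exp (redwords (@None (letter m)) l) N (fun Rs => (P Rs)%:R : R)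
    + Exp (redwords (@None (letter m)) l) N (fun Rs => (~~ P Rs)%:R) = 1.
  by rewrite -ExpD -[RHS](Exp_cst W_gt0 N); apply: eq_Exp => Rs; case: (P Rs);
    rewrite ?addr0 ?add0r.
rewrite probE; apply/andP; split; last first.
  by rewrite -[leRHS](Exp_cst W_gt0 N); apply: le_Exp => Rs _ _; rewrite lern1 leq_b1.
rewrite lerBlDr -[leLHS]compl lerD2l.
have := @collapse_prob R m k J e q m_gt1 q_gt0 J_ge N leN; rewrite -el => /le_trans; apply.
rewrite /branch_error /glue_error -el.
set X := n%:R ^+ l / _; set Y := l%:R / _.
have nk0 : 0 < n%:R ^+ k :> R by apply: exprn_gt0.
have M2 : (2 * m <= 2 * n)%N by lia.
have l_gt0 : (0 < l)%N by lia.
have B_le : (B <= l)%N.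
  have : (B <= n ^ B * B)%N by rewrite leq_pmull // expn_gt0 n_gt0.
  lia.
have n0' := ltW n0; have q0' := ltW q0.
have XW : (size (redwords (@None (letter m)) l))%:R / (q%:R ^+ 2 * n%:R ^+ k) <= 2 * X.
  rewrite /X [_ ^+ k * _]mulrC mulrA ler_wpM2r ?invr_ge0 ?mulr_ge0 ?exprn_ge0 //.
  rewrite -natrX -natrM ler_nat sizeW -[in leqRHS](prednK l_gt0) expnS mulnA.
  by rewrite leq_mul2r M2 orbT.
(* As [B = 2k + 4] exceeds [k], there are at most [2 n^(l-k)] shortened words, so both birthday
   arguments share the error term [X]. *)
have Xv : (2 * m * n ^ (l - B))%:R / q%:R ^+ 2 <= 2 * X.
  have -> : 2 * X = 2 * n%:R ^+ l / n%:R ^+ k / q%:R ^+ 2.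
    by rewrite /X [in LHS]invfM !mulrA.
  rewrite ler_wpM2r ?invr_ge0 ?exprn_ge0 //.
  rewrite ler_pdivlMr // -!natrX -!natrM ler_nat.
  apply: leq_trans (_ : 2 * n * n ^ (l - B) * n ^ k <= _)%N.
    by rewrite !leq_mul2r M2 !orbT.
  by rewrite -!mulnA -expnD -expnS leq_mul2l leq_pexp2l //= /B; lia.
have nY : n%:R / q%:R <= n%:R * Y.
  rewrite /Y mulrA ler_wpM2r ?invr_ge0 // ler_peMr //.
  by rewrite ler1n.
have X0 : 0 <= X by rewrite /X divr_ge0 ?mulr_ge0 ?exprn_ge0.
have Y0 : 0 <= Y by rewrite /Y divr_ge0 ?ler0n.
have c0 : 0 <= 4 * n%:R ^+ 4 :> R by rewrite mulr_ge0 ?exprn_ge0.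
have := ler_wpM2l c0 Xv; rewrite mulrA => Xv'.
have m0 : 0 <= (2 * m)%:R ^+ 2 :> R by rewrite exprn_ge0.
apply: le_trans (_ : 2 * X + 2 * (n%:R * Y) + (2 * m)%:R ^+ 2 *
   (4 * n%:R ^+ 4 * (2 * X) + 8 * n%:R ^+ 4 * Y) <= _).
  apply: lerD; first by rewrite lerD // -mulrA ler_wpM2l.
  by rewrite ler_wpM2l // lerD // /Y mulrA.
rewrite natrM /bound_const -subr_ge0.
have -> : (2 + 2 * n%:R + 32 * m%:R ^+ 2 * n%:R ^+ 4) * (X + Y) -
 (2 * X + 2 * (n%:R * Y) + (2 * m%:R) ^+ 2 * (4 * n%:R ^+ 4 * (2 * X) + 8 * n%:R ^+ 4 * Y))
 = 2 * n%:R * X + 2 * Y by ring.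
by have := mulr_ge0 n0' X0; move=> ?; lra.
Qed.
End Bound.

(** * Asymptotics *)

Section Asymptotics.
Import Stdlib.setoid_ring.Field_tac.
Variables (m : nat) (f : nat -> R) (k : nat -> nat).
Hypothesis m_gt1 : (1 < m)%N.
Local Notation n := (2 * m - 1)%N.
Local Notation small := (fun Rs : seq (word m) =>
  presented_iso Rs trivial_grp \/ presented_iso Rs Z2_grp).
Local Open Scope R_scope.

Lemma bound_const_pos : 0 <= bound_const m.
Proof.
apply/RleP; rewrite /bound_const.
by rewrite !(Num.Theory.addr_ge0, Num.Theory.mulr_ge0, Num.Theory.exprn_ge0, Num.Theory.ler0n).
Qed.

Lemma prob_H_boundR l j q (B := (2 * j.+1).+2) :
  (n ^ B * B + 3 <= l)%N -> (0 < q)%N -> (4 * q <= nrel m f l)%N ->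
  1 - bound_const m * (INR n ^ l / (INR n ^ j * INR q ^ 2) + INR l / INR q)
    <= prob_H f small l <= 1.
Proof.
move=> h1 h2 h3; have /andP[/RleP lo /RleP up] := prob_H_bound m_gt1 h1 h2 h3.
split => //; apply: Rle_trans lo; apply: Req_le.
by rewrite !INRE !RpowE.
Qed.

Let n_ge3 : 3 <= INR n.
Proof.
have -> : 3 = INR 3 by rewrite INR_IZR_INZ.
by apply: le_INR; apply/leP; lia.
Qed.

(** Holds since [n >= 3 >= e]; it allows powers of [n] to be bounded below by exponentials. *)
Lemma ln_n_ge1 : 1 <= ln (INR n).
Proof.
rewrite -(ln_exp 1); have e := Rle_trans _ _ _ exp_le_3 n_ge3.
case: (Rle_lt_or_eq_dec _ _ e) => [lt|<-]; last exact: Rle_refl.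
by left; apply: ln_increasing => //; apply: exp_pos.
Qed.

Local Notation a l := (Rpower (INR n) (INR l * (/ 2 - f l))).

Lemma nrel_ge l : a l - 1 < INR (nrel m f l).
Proof.
have [h1 h2] := base_Int_part (a l).
have a0 : 0 < a l by apply: exp_pos.
have i0 : Z.le Z0 (Int_part (a l)).
  by apply/BinInt.Z.lt_succ_r/lt_IZR; rewrite succ_IZR; Lra.lra.
by rewrite /nrel (INR_IZR_INZ (BinInt.Z.to_nat _)) Znat.Z2Nat.id //; Lra.lra.
Qed.

(** The exponent is at least [l/4], and [exp (l/4) = exp (l/8)^2 >= (l/8)^2]. *)
Lemma many_relators l : Rabs (f l) < / 4 -> (64 <= l)%N ->
  8 <= a l /\ INR l / a l <= 64 / INR l.
Proof.
move=> fl l64; have lR : 64 <= INR l.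
  have -> : 64 = INR 64 by rewrite INR_IZR_INZ.
  by apply: le_INR; apply/leP.
have := Rle_abs (f l) => fle.
have al : exp (INR l / 4) <= a l.
  rewrite /Rpower; have := ln_n_ge1; set L := ln _ => L1.
  have u : INR l / 4 <= INR l * (/ 2 - f l) by Lra.nra.
  have e : INR l / 4 <= INR l * (/ 2 - f l) * L by Lra.nra.
  by case: (Rle_lt_or_eq_dec _ _ e) => [lt|<-]; [left; apply: exp_increasing|right].
have sq : (INR l / 8) * (INR l / 8) <= a l.
  apply: Rle_trans al.
  have -> : INR l / 4 = INR l / 8 + INR l / 8 by Lra.lra.
  rewrite exp_plus; have := exp_ineq1_le (INR l / 8) => ?.
  by apply: Rmult_le_compat; Lra.lra.
split; first Lra.nra.
apply: (Rmult_le_reg_r (a l)); first by Lra.nra.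
have -> : INR l / a l * a l = INR l by field; Lra.nra.
apply: (Rmult_le_reg_r (INR l)); first by Lra.nra.
have -> : 64 / INR l * a l * INR l = 64 * a l by field; Lra.nra.
Lra.nra.
Qed.

(** With [g = k - 2lf] and [A] the relator count before rounding, [n^k A^2 = n^(l+g)] and
    [n^g >= g]. Together with [q >= A/8] this bounds the first term by [64/g]. *)
Lemma error_bound l : Rabs (f l) < / 4 -> (64 <= l)%N ->
  0 < INR (k l) - 2 * (INR l * f l) ->
  exists q, [/\ (0 < q)%N, (4 * q <= nrel m f l)%N &
    INR n ^ l / (INR n ^ k l * INR q ^ 2) + INR l / INR q <=
    64 / (INR (k l) - 2 * (INR l * f l)) + 512 / INR l].
Proof.
move=> fl l64 g0; have [a8 la] := many_relators fl l64.
have Nge := nrel_ge l; set N := nrel m f l in Nge *.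
set g := INR (k l) - _ in g0 *; set A := a l in a8 la Nge *.
exists (N %/ 4)%N; set q := (N %/ 4)%N.
have Nq : (N < 4 * q + 4)%N by rewrite /q; lia.
(* Here [A >= 8] absorbs the rounding in [N] and in its quarter. *)
have qA : A / 8 <= INR q.
  have /le_INR : le (Nat.add N 1) (Nat.add (Nat.mul 4 q) 4).
    by apply/leP; rewrite plusE multE addn1.
  by rewrite !plus_INR /= => ?; Lra.lra.
have q0 : 0 < INR q by Lra.lra.
have q_gt0 : (0 < q)%N by apply/ltP/INR_lt.
split => //; first by rewrite /q; lia.
have n0 : 0 < INR n by Lra.lra.
have l0 : 0 < INR l by apply: lt_0_INR; apply/ltP; lia.
apply: Rplus_le_compat; last first.
  apply: (Rle_trans _ (8 * (INR l / A))); last by Lra.lra.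
  apply: (Rmult_le_reg_r (INR q)) => //.
  have -> : INR l / INR q * INR q = INR l by field; Lra.lra.
  apply: (Rmult_le_reg_r A); first Lra.lra.
  have -> : 8 * (INR l / A) * INR q * A = 8 * INR l * INR q by field; Lra.lra.
  Lra.nra.
have A2 : A * A = Rpower (INR n) (INR l - 2 * (INR l * f l)).
  by rewrite -Rpower_plus; congr Rpower; field.
have key : INR n ^ l * g <= INR n ^ k l * (A * A).
  rewrite A2 -!Rpower_pow // -Rpower_plus.
  have -> : INR (k l) + (INR l - 2 * (INR l * f l)) = INR l + g by rewrite /g; Lra.lra.
  rewrite Rpower_plus; apply: Rmult_le_compat_l; first by left; apply: exp_pos.
  rewrite /Rpower; have := ln_n_ge1; set L := ln _ => L1.
  have := exp_ineq1_le (g * L); Lra.nra.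
have nk0 : 0 < INR n ^ k l by apply: pow_lt.
apply: (Rmult_le_reg_r g) => //.
have -> : 64 / g * g = 64 by field; Lra.lra.
apply: (Rmult_le_reg_r (INR n ^ k l * INR q ^ 2)).
  by apply: Rmult_lt_0_compat; apply: pow_lt.
have -> : INR n ^ l / (INR n ^ k l * INR q ^ 2) * g * (INR n ^ k l * INR q ^ 2)
  = INR n ^ l * g.
  by field; split; [Lra.lra | apply: pow_nonzero; Lra.lra].
apply: Rle_trans key _.
have : A * A <= 64 * INR q ^ 2 by rewrite /=; Lra.nra.
set y := INR n ^ k l in nk0 *; set w := A * A; set t := INR q ^ 2 => h1.
have w0 : 0 <= w by rewrite /w; Lra.nra.
have : y * w <= y * (64 * t) by apply: Rmult_le_compat_l; Lra.lra.
Lra.nra.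
Qed.
(** Blocks have length [2k + 4]: compared with the hypothesis this costs [n^4] in the power and at
    most 2 in the linear factor, as [2k + 4 <= 2(2k + 2)]. *)
Lemma long_relators l : (2 * INR n ^ 4 + 1 <
    (INR l - 2) / ((2 * INR (k l) + 2) * INR n ^ (2 * k l))) ->
  (n ^ (2 * (k l).+1).+2 * (2 * (k l).+1).+2 + 3 <= l)%N.
Proof.
set x := INR (k l); set y := INR n ^ (2 * k l) => h.
have x0 : 0 <= x := pos_INR _.
have y1 : 1 <= y by apply: pow_R1_Rle; Lra.lra.
have xy : 2 <= (2 * x + 2) * y by Lra.nra.
have {}h : (2 * INR n ^ 4 + 1) * ((2 * x + 2) * y) < INR l - 2.
  have -> : INR l - 2 = (INR l - 2) / ((2 * x + 2) * y) * ((2 * x + 2) * y).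
    by field; Lra.nra.
  by apply: Rmult_lt_compat_r h; Lra.lra.
rewrite addn3; apply/ltP/INR_lt; rewrite 2!S_INR.
apply: (Rle_lt_trans _ (INR n ^ 4 * y * (2 * x + 4) + 2)).
  have -> : ((2 * (k l).+1).+2 = 2 * k l + 4)%N by lia.
  have INR_M a b : INR (a * b)%N = INR a * INR b := mult_INR a b.
  have INR_D a b : INR (a + b)%N = INR a + INR b := plus_INR a b.
  rewrite INR_M INR_D INR_M -/x.
  have -> : INR (n ^ (2 * k l + 4)) = y * INR n ^ 4.
    by rewrite /y -pow_add !INRE ssralg.GRing.natrX RpowE.
  have -> : INR 4 = 4 by rewrite INR_IZR_INZ.
  by have -> : INR 2 = 2; [rewrite INR_IZR_INZ | Lra.lra].
have z0 : 0 <= INR n ^ 4 by apply: pow_le; Lra.lra.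
have : 0 <= INR n ^ 4 * (x * y) by apply: Rmult_le_pos => //; Lra.nra.
Lra.nra.
Qed.

Lemma aas_small :
  Un_cv f (INR 0) ->
  cv_infty (fun l => INR (k l) - INR 2 * (INR l * f l)) ->
  cv_infty (fun l => (INR l - INR 2) /
    ((INR 2 * INR (k l) + INR 2) * INR n ^ (2 * k l))) ->
  @aas m f small.
Proof.
move=> f0 g_inf h_inf eps eps0; set C := bound_const m.
have C0 : 0 <= C := bound_const_pos.
have [N1 H1] := f0 (/ 4) ltac:(Lra.lra).
have [N2 H2] := g_inf (64 * (2 * C + 1) / eps).
have [N3 H3] := h_inf (2 * INR n ^ 4 + 1).
have [N4 H4] := INR_unbounded (512 * (2 * C + 1) / eps).
exists (N1 + N2 + N3 + N4 + 64)%N => l /leP l_ge; rewrite /Rdist.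
have fl : Rabs (f l) < / 4.
  by have := H1 l ltac:(apply/leP; lia); rewrite /Rdist /= Rminus_0_r.
have gl : 64 * (2 * C + 1) / eps < INR (k l) - 2 * (INR l * f l).
  by apply: (H2 l); apply/leP; lia.
have hl : 2 * INR n ^ 4 + 1 < (INR l - 2) / ((2 * INR (k l) + 2) * INR n ^ (2 * k l)).
  by apply: (H3 l); apply/leP; lia.
have lR : 512 * (2 * C + 1) / eps < INR l.
  by apply: Rlt_le_trans H4 _; apply: le_INR; apply/leP; lia.
have l64 : (64 <= l)%N by lia.
(* Each of the two errors gets half of [eps]. Using [2C + 1] instead of [2C] keeps the threshold
   positive even for [C = 0] and the inequality strict. *)
have small_ratio c t : 0 < c -> c * (2 * C + 1) / eps < t -> 0 < t /\ C * (c / t) < eps / 2.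
  move=> c0 ct; have c1 : 0 < c * (2 * C + 1) / eps.
    by apply: Rdiv_lt_0_compat => //; Lra.nra.
  have t0 : 0 < t by Lra.lra.
  split => //; apply: (Rmult_lt_reg_r t) => //.
  have -> : C * (c / t) * t = C * c by field; Lra.lra.
  have : c * (2 * C + 1) / eps * eps = c * (2 * C + 1) by field; Lra.lra.
  set r := _ / eps in ct * => e; Lra.nra.
have [g0 gC] := small_ratio 64 _ ltac:(Lra.lra) gl.
have [l0 lC] := small_ratio 512 _ ltac:(Lra.lra) lR.
have [q [q_gt0 leN err]] := error_bound fl l64 g0.
have [lo up] := prob_H_boundR (long_relators hl) q_gt0 leN.
have := Rmult_le_compat_l _ _ _ C0 err; rewrite -/C in lo => {}err.
by rewrite /Rabs; case: Rcase_abs => _; Lra.lra.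
Qed.

End Asymptotics.

Theorem theorem3p1 (m : nat) (f : nat -> R) (k : nat -> nat) :
  (2 <= m)%N ->
  Un_cv f (INR 0) ->
  (forall l, (k l <= l)%N) ->
  cv_infty (fun l => Rminus (INR (k l)) (Rmult (INR 2) (Rmult (INR l) (f l)))) ->
  cv_infty (fun l => Rdiv (Rminus (INR l) (INR 2))
               (Rmult (Rplus (Rmult (INR 2) (INR (k l))) (INR 2))
                      (pow (INR (2 * m - 1)) (2 * k l)))) ->
  @aas m f (fun Rs : seq (word m) => presented_iso Rs trivial_grp \/ presented_iso Rs Z2_grp).
Proof.
by move=> m_gt1 f0 _ g_inf h_inf; apply: aas_small h_inf.
Qed.
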